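(* There is an absolute constant $C>0$ such that the following holds. Let $A\in\mathbb{R}^{m\times n}$ have full row rank $m\le n$, let $b\in\mathbb{R}^m$, $c\in\mathbb{R}^n$, let $\epsilon>0$, and let $(x_0,y_0,s_0)\in\mathcal{N}_2(0.25)$ be a feasible starting point (that is, $Ax_0=b$ and $A^Ty_0+s_0=c$) with duality measure $\mu_0\ge 2\epsilon$. Run the error-adjusted inexact predictor-corrector algorithm (described in the context) from $(x_0,y_0,s_0)$, where the solver $\mathsf{SolveV}$ is called twice in each outer iteration with error tolerance $\epsilon/2^7$. Then, after at most $C\sqrt{n}\,\log(\mu_0/\epsilon)$ outer iterations, the algorithm terminates at a primal-dual feasible point $(x^*,y^*,s^* )$ (that is, $Ax^*=b$, $x^*\ge0$, $A^Ty^*+s^*=c$, $s^*\ge0$) whose duality measure $\mu^*=\frac1n (x^* )^Ts^*$ satisfies $\mu^*<2\epsilon$.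
   Context: The linear program is $\min c^Tx$ subject to $Ax=b$, $x\ge 0$, with dual $\max b^Ty$ subject to $A^Ty+s=c$, $s\ge0$. Notation. $\mathbf{1}_n$ is the all-ones vector and $\circ$ the entrywise product. For a point $(x,y,s)$ with $x,s\in\mathbb{R}^n$ entrywise positive and $y\in\mathbb{R}^m$: $X=\mathrm{diag}(x)$, $S=\mathrm{diag}(s)$, $D=X^{1/2}S^{-1/2}$ (so $D^2=XS^{-1}$), and the duality measure is $\mu=\frac1n x^Ts$. For $\theta\in(0,1)$, $\mathcal{N}_2(\theta)=\{(x,y,s)\in\mathbb{R}^{n}\times\mathbb{R}^m\times\mathbb{R}^n:\ \|x\circ s-\mu\mathbf{1}_n\|_2\le\theta\mu,\ (x,s)>0\}$. Solver. $\mathsf{SolveV}(AD^2A^T,p,\delta)$ returns any pair $(\widetilde{\Delta y},v)\in\mathbb{R}^m\times\mathbb{R}^n$ with $AD^2A^T\widetilde{\Delta y}=p+AS^{-1}v$ and $\|v\|_2<\delta$. Error-adjusted step. For centering parameter $\sigma\in[0,1]$, given $(\widetilde{\Delta y},v)$, set $\widetilde{\Delta s}=-A^T\widetilde{\Delta y}$ and $\widetilde{\Delta x}=-x+\sigma\mu S^{-1}\mathbf{1}_n-D^2\widetilde{\Delta s}-S^{-1}v$. Algorithm. Start at $(x_0,y_0,s_0)$. While the current iterate has $\mu\ge2\epsilon$, perform one outer iteration: Predictor step ($\sigma=0$): compute $(\widetilde{\Delta y},v)=\mathsf{SolveV}(AD^2A^T,Ax,\epsilon/2^7)$ and then $\widetilde{\Delta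 s}=-A^T\widetilde{\Delta y}$ and $\widetilde{\Delta x}=-x-D^2\widetilde{\Delta s}-S^{-1}v$ (the error-adjusted step with $\sigma=0$); set $\alpha=\min\{\frac12,(\mu/(16\|\widetilde{\Delta x}\circ\widetilde{\Delta s}\|_2))^{1/2}\}$ (with $\alpha=\frac12$ if $\widetilde{\Delta x}\circ\widetilde{\Delta s}=0$); replace $(x,y,s)$ by $(x,y,s)+\alpha(\widetilde{\Delta x},\widetilde{\Delta y},\widetilde{\Delta s})$. Corrector step ($\sigma=1$): with $D,S,\mu$ recomputed at the new point, compute $(\widetilde{\Delta y},v)=\mathsf{SolveV}(AD^2A^T,-\mu AS^{-1}\mathbf{1}_n+Ax,\epsilon/2^7)$ and then $\widetilde{\Delta s},\widetilde{\Delta x}$ with $\sigma=1$; replace $(x,y,s)$ by $(x,y,s)+(\widetilde{\Delta x},\widetilde{\Delta y},\widetilde{\Delta s})$. *)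

(* Defs.v *)
From HB Require Import structures.
From mathcomp Require Import all_boot all_order all_algebra.
From mathcomp Require Import all_classical all_reals all_analysis.

Set Implicit Arguments.
Unset Strict Implicit.
Unset Printing Implicit Defensive.

Import Order.TTheory GRing.Theory Num.Theory.
Local Open Scope ring_scope.

Section Defs.
Variables (R : realType) (m n : nat).

(* The norm that MathComp-Analysis puts on matrices is the sup norm. *)
Definition norm2 (u : 'cV[R]_n) : R := Num.sqrt (\sum_i u i 0 ^+ 2).

Definition entrywise_mul (u v : 'cV[R]_n) : 'cV[R]_n := map2_mx *%R u v.

Definition ones : 'cV[R]_n := const_mx 1.

Definition diagc (u : 'cV[R]_n) : 'M[R]_n := diag_mx u^T.

Definition entrywise_pos (u : 'cV[R]_n) : Prop := forall i, 0 < u i 0.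

Definition entrywise_ge0 (u : 'cV[R]_n) : Prop := forall i, 0 <= u i 0.

(* A point (x, y, s). *)
Record iterate := Iterate {
  primal : 'cV[R]_n;
  dual : 'cV[R]_m;
  slack : 'cV[R]_n }.

Definition duality_measure (z : iterate) : R :=
  n%:R^-1 * ((primal z)^T *m slack z) 0 0.

Definition positive_iterate (z : iterate) : Prop :=
  entrywise_pos (primal z) /\ entrywise_pos (slack z).

Definition in_N2 (theta : R) (z : iterate) : Prop :=
  let mu := duality_measure z in
  norm2 (entrywise_mul (primal z) (slack z) - mu *: ones) <= theta * mu
  /\ positive_iterate z.

Definition primal_dual_feasible (A : 'M[R]_(m, n)) (b : 'cV[R]_m)
    (c : 'cV[R]_n) (z : iterate) : Prop :=
  [/\ A *m primal z = b, entrywise_ge0 (primal z),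
      A^T *m dual z + slack z = c & entrywise_ge0 (slack z)].

Definition Sinv (z : iterate) : 'M[R]_n := invmx (diagc (slack z)).

(* D = X^{1/2} S^{-1/2} *)
Definition scaling (z : iterate) : 'M[R]_n :=
  diagc (map_mx Num.sqrt (primal z))
  *m invmx (diagc (map_mx Num.sqrt (slack z))).

Definition scaling2 (z : iterate) : 'M[R]_n := scaling z *m scaling z.

(* The pairs (dy, v) that SolveV (A D^2 A^T, p, delta) may return at z. *)
Definition SolveV (A : 'M[R]_(m, n)) (z : iterate) (p : 'cV[R]_m) (delta : R)
    (dy : 'cV[R]_m) (v : 'cV[R]_n) : Prop :=
  (A *m scaling2 z *m A^T) *m dy = p + A *m Sinv z *m v /\ norm2 v < delta.

Definition step_ds (A : 'M[R]_(m, n)) (dy : 'cV[R]_m) : 'cV[R]_n :=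
  - (A^T *m dy).

Definition step_dx (A : 'M[R]_(m, n)) (sigma : R) (z : iterate)
    (dy : 'cV[R]_m) (v : 'cV[R]_n) : 'cV[R]_n :=
  - primal z + (sigma * duality_measure z) *: (Sinv z *m ones)
  - scaling2 z *m step_ds A dy - Sinv z *m v.

Definition move (z : iterate) (alpha : R) (dx : 'cV[R]_n) (dy : 'cV[R]_m)
    (ds : 'cV[R]_n) : iterate :=
  Iterate (primal z + alpha *: dx) (dual z + alpha *: dy)
          (slack z + alpha *: ds).

Definition predictor_step_size (mu : R) (dx ds : 'cV[R]_n) : R :=
  if entrywise_mul dx ds == 0 then 2^-1
  else Num.min 2^-1 (Num.sqrt (mu / (16 * norm2 (entrywise_mul dx ds)))).

(* The steps are relations because SolveV may return any admissible pair.
   They are defined only at positive iterates, where S^{-1} and S^{-1/2} are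
   genuine inverses; that no run leaves this domain is part of
   [terminates_within], through [iteration_defined]. *)
Definition predictor_step (A : 'M[R]_(m, n)) (eps : R) (z z' : iterate)
    : Prop :=
  positive_iterate z /\
  exists (dy : 'cV[R]_m) (v : 'cV[R]_n),
    SolveV A z (A *m primal z) (eps / 2 ^+ 7) dy v /\
    let ds := step_ds A dy in
    let dx := step_dx A 0 z dy v in
    z' = move z (predictor_step_size (duality_measure z) dx ds) dx dy ds.

Definition corrector_step (A : 'M[R]_(m, n)) (eps : R) (z z' : iterate)
    : Prop :=
  positive_iterate z /\
  exists (dy : 'cV[R]_m) (v : 'cV[R]_n),
    SolveV A z
      (- (duality_measure z *: (A *m Sinv z *m ones)) + A *m primal z)
      (eps / 2 ^+ 7) dy v /\
    z' = move z 1 (step_dx A 1 z dy v) dy (step_ds A dy).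

Definition outer_iteration (A : 'M[R]_(m, n)) (eps : R) (z z' : iterate)
    : Prop :=
  exists2 w, predictor_step A eps z w & corrector_step A eps w z'.

(* Whatever the solver returns, the iteration from z does not get stuck. *)
Definition iteration_defined (A : 'M[R]_(m, n)) (eps : R) (z : iterate)
    : Prop :=
  (exists w, predictor_step A eps z w) /\
  (forall w, predictor_step A eps z w -> exists z', corrector_step A eps w z').

(* Every run of the loop from z, for all possible solver answers, stops after
   at most k outer iterations, and does so at a point satisfying Q. *)
Fixpoint terminates_within (A : 'M[R]_(m, n)) (eps : R) (Q : iterate -> Prop)
    (k : nat) (z : iterate) : Prop :=
  if 2 * eps <= duality_measure z then
    if k is k'.+1 then
      iteration_defined A eps z /\
      forall z', outer_iteration A eps z z' -> terminates_within A eps Q k' z'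
    else False
  else Q z.

End Defs.

(* Main.v *)
(** With [D^2 = X S^{-1}], an error-adjusted step satisfies [A dx = 0] exactly
    and [s o dx + x o ds = sigma mu 1 - x o s - v], so [dx] and [ds] are
    orthogonal, feasibility is preserved, and the solver error [v] only perturbs
    the complementarity products: after a step of length [alpha],
      [mu' = (1 - alpha + alpha sigma) mu - alpha mean(v)],
      [|x' o s' - mu' 1| <= (1 - alpha) |x o s - mu 1| + alpha |v|
                            + alpha^2 |dx o ds|].
    Orthogonality also gives
      [|dx o ds| <= 1/2 sum_i (sigma mu - x_i s_i - v_i)^2 / (x_i s_i)].
    For the predictor the right-hand side is at most [n mu], so
    [alpha >= 1 / (4 sqrt n)] and the new point lies in N_2(2/5); for the
    corrector it is at most [0.15 mu], which brings the point back to N_2(1/4).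
    Since [|mean(v)| <= |v| / sqrt n], the errors cost a small multiple of
    [mu / sqrt n], and [mu] shrinks by a factor [1 - 1 / (8 sqrt n)] in each
    outer iteration. *)

Require Import Defs.
From HB Require Import structures.
From mathcomp Require Import all_boot all_order all_algebra.
From mathcomp Require Import all_classical all_reals all_analysis.
From mathcomp Require Import ring lra.

Set Implicit Arguments.
Unset Strict Implicit.
Unset Printing Implicit Defensive.

Import Order.TTheory GRing.Theory Num.Theory.
Local Open Scope ring_scope.

(** * The Euclidean norm: Cauchy-Schwarz, triangle inequality, centering *)

Section Norm2.
Variables (R : realType) (n : nat).
Implicit Types u v : 'cV[R]_n.

Lemma sum_sqr_ge0 u : 0 <= \sum_i u i 0 ^+ 2.
Proof. by apply: sumr_ge0 => i _; apply: sqr_ge0. Qed.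

Lemma norm2_ge0 u : 0 <= norm2 u.
Proof. exact: sqrtr_ge0. Qed.

Lemma sqr_norm2 u : norm2 u ^+ 2 = \sum_i u i 0 ^+ 2.
Proof. by rewrite sqr_sqrtr // sum_sqr_ge0. Qed.

Lemma norm2_le u (a : R) : 0 <= a ->
  (norm2 u <= a) = (\sum_i u i 0 ^+ 2 <= a ^+ 2).
Proof. by move=> a0; rewrite -sqr_norm2 ler_sqr ?nnegrE ?norm2_ge0. Qed.

Lemma norm2_0 : norm2 (0 : 'cV[R]_n) = 0.
Proof. by rewrite /norm2 big1 ?sqrtr0 // => i _; rewrite mxE expr0n. Qed.

Lemma norm2Z (a : R) u : norm2 (a *: u) = `|a| * norm2 u.
Proof.
rewrite /norm2 -sqrtr_sqr -sqrtrM ?sqr_ge0 // mulr_sumr.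
by congr Num.sqrt; apply: eq_bigr => i _; rewrite mxE exprMn.
Qed.

Lemma norm2N u : norm2 (- u) = norm2 u.
Proof. by rewrite -scaleN1r norm2Z normrN1 mul1r. Qed.

(** Cauchy-Schwarz from Lagrange's identity: the double sum of [(u_i v_j - u_j v_i)^2] is twice the
    difference of the squares of the two sides. *)
Lemma sum_mul_le_norm2 u v : \sum_i u i 0 * v i 0 <= norm2 u * norm2 v.
Proof.
apply: le_trans (ler_norm _) _.
rewrite -ler_sqr ?nnegrE ?mulr_ge0 ?norm2_ge0 // real_normK ?num_real //.
rewrite exprMn !sqr_norm2.
have : 0 <= \sum_i \sum_j (u i 0 * v j 0 - u j 0 * v i 0) ^+ 2.
  by apply: sumr_ge0 => i _; apply: sumr_ge0 => j _; apply: sqr_ge0.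
have -> : \sum_i \sum_j (u i 0 * v j 0 - u j 0 * v i 0) ^+ 2 =
    \sum_i \sum_j (u i 0 ^+ 2 * v j 0 ^+ 2)
    + \sum_i \sum_j (u j 0 ^+ 2 * v i 0 ^+ 2)
    - 2 * \sum_i \sum_j (u i 0 * v i 0 * (u j 0 * v j 0)).
  rewrite mulr_sumr -big_split -sumrB; apply: eq_bigr => i _.
  rewrite mulr_sumr -big_split -sumrB; apply: eq_bigr => j _ /=; ring.
rewrite [X in _ + X - _]exchange_big /= -!big_distrlr /= -expr2.
lra.
Qed.

Lemma norm2D u v : norm2 (u + v) <= norm2 u + norm2 v.
Proof.
rewrite norm2_le ?addr_ge0 ?norm2_ge0 // sqrrD !sqr_norm2.
under eq_bigr do rewrite mxE sqrrD.
rewrite !big_split /= lerD2r lerD2l.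
by rewrite mulr2n lerD ?sum_mul_le_norm2.
Qed.

Lemma entry_le_norm2 u i : `|u i 0| <= norm2 u.
Proof.
rewrite -sqrtr_sqr ler_wsqrtr // (bigD1 i) //= lerDl.
by apply: sumr_ge0 => j _; apply: sqr_ge0.
Qed.

Lemma norm2_le_sum_norm u : norm2 u <= \sum_i `|u i 0|.
Proof.
have s0 : 0 <= \sum_i `|u i 0| by apply: sumr_ge0.
rewrite norm2_le // expr2 big_distrl /=; apply: ler_sum => i _.
rewrite -real_normK ?num_real // expr2 ler_wpM2l //.
by rewrite (bigD1 i) //= lerDl sumr_ge0.
Qed.

(** Cauchy-Schwarz against the all-ones vector, applied to both [u] and [- u]. *)
Lemma norm_sum_le_norm2 u : `|\sum_i u i 0| <= Num.sqrt n%:R * norm2 u.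
Proof.
have n1 : norm2 (ones R n) = Num.sqrt n%:R.
  congr Num.sqrt; under eq_bigr do rewrite mxE expr1n.
  by rewrite sumr_const card_ord.
have h (w : 'cV[R]_n) : \sum_i w i 0 <= Num.sqrt n%:R * norm2 w.
  have := sum_mul_le_norm2 (ones R n) w; rewrite n1.
  by under eq_bigr do rewrite mxE mul1r.
rewrite ler_norml h andbT lerNl -sumrN.
rewrite -(norm2N u); apply: le_trans (h (- u)).
by under [leRHS]eq_bigr do rewrite mxE.
Qed.

(** Removing the mean is an orthogonal projection: the sum of squares drops by n times the squared
    mean. *)
Lemma norm2_centered u :
  norm2 (u - (n%:R^-1 * \sum_i u i 0) *: ones R n) <= norm2 u.
Proof.
rewrite norm2_le ?norm2_ge0 // sqr_norm2.
case: (posnP n) => [n0|n0].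
  by subst n; rewrite !big_ord0.
have nR : n%:R != 0 :> R by rewrite pnatr_eq0 -lt0n.
set a := _^-1 * _.
have sa : \sum_i u i 0 = n%:R * a by rewrite /a mulrA divff // mul1r.
have -> : \sum_i (u - a *: ones R n) i 0 ^+ 2 =
    \sum_i u i 0 ^+ 2 - n%:R * a ^+ 2.
  transitivity (\sum_i (u i 0 ^+ 2 - 2 * a * u i 0 + a ^+ 2)).
    by apply: eq_bigr => i _; rewrite !mxE; ring.
  rewrite big_split sumrB /= -mulr_sumr sumr_const card_ord sa -mulr_natl; ring.
by rewrite lerBlDr lerDl mulr_ge0 ?sqr_ge0.
Qed.

End Norm2.

(** * Diagonal matrices and their inverses *)

Section Diagonal.
Variables (R : realType) (n : nat).
Implicit Types u v : 'cV[R]_n.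

Lemma diagc_mulE u v i : (diagc u *m v) i 0 = u i 0 * v i 0.
Proof. by rewrite mul_diag_mx !mxE. Qed.

Lemma invmx_diagc u : entrywise_pos u ->
  invmx (diagc u) = diagc (map_mx GRing.inv u).
Proof.
move=> u0.
have h : diagc u *m diagc (map_mx GRing.inv u) = 1%:M.
  rewrite mulmx_diag -diag_const_mx; congr diag_mx.
  by apply/rowP => j; rewrite !mxE divff // gt_eqF.
have [uU _] := mulmx1_unit h.
by rewrite -[RHS](mulKmx uU) h mulmx1.
Qed.

End Diagonal.

Lemma entrywise_mulE (R : realType) n (u v : 'cV[R]_n) i :
  entrywise_mul u v i 0 = u i 0 * v i 0.
Proof. by rewrite mxE. Qed.

(** * Scaling matrices, solvability of the normal equations, complementarity products *)

Section Step.
Variables (R : realType) (m n : nat).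
Implicit Types (z w : iterate R m n) (A : 'M[R]_(m, n)) (v : 'cV[R]_n).

Lemma Sinv_mulE z v i : entrywise_pos (slack z) ->
  (Sinv z *m v) i 0 = (slack z i 0)^-1 * v i 0.
Proof. by move=> s0; rewrite /Sinv invmx_diagc // diagc_mulE mxE. Qed.

Lemma scalingE z : positive_iterate z ->
  scaling z = diagc (\col_i (Num.sqrt (primal z i 0) / Num.sqrt (slack z i 0))).
Proof.
move=> [_ s0]; rewrite /scaling invmx_diagc.
  by rewrite mulmx_diag; congr diag_mx; apply/rowP => j; rewrite !mxE.
by move=> i; rewrite mxE sqrtr_gt0.
Qed.

Lemma scaling2_mulE z v i : positive_iterate z ->
  (scaling2 z *m v) i 0 = primal z i 0 / slack z i 0 * v i 0.
Proof.
move=> zP; have [x0 s0] := zP.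
rewrite /scaling2 scalingE // -mulmxA !diagc_mulE !mxE mulrA; congr (_ * _).
by rewrite mulrACA -invfM -!expr2 !sqr_sqrtr ?ltW.
Qed.

(** A left kernel vector [u] makes the sum of [(x_i / s_i) (u A)_i^2] vanish. The weights are
    positive, so [u A = 0], and full row rank gives [u = 0]. *)
Lemma normal_matrix_unit A z : row_free A -> positive_iterate z ->
  A *m scaling2 z *m A^T \in unitmx.
Proof.
move=> Afree zP; rewrite -row_free_unit; apply: inj_row_free => u uM.
pose p := (u *m A)^T.
suff p0 : p = 0.
  by apply/eqP; rewrite -(mulmx_free_eq0 u Afree) -[u *m A]trmxK -/p p0 trmx0.
have : (u *m (A *m scaling2 z *m A^T) *m u^T) 0 0 = 0.
  by rewrite uM mul0mx mxE.
have -> : u *m (A *m scaling2 z *m A^T) *m u^T = p^T *m (scaling2 z *m p).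
  by rewrite /p trmx_mul !trmx_mul !trmxK !mulmxA.
have [x0 s0] := zP.
have E i : p^T 0 i * (scaling2 z *m p) i 0 =
    primal z i 0 / slack z i 0 * p i 0 ^+ 2.
  by rewrite scaling2_mulE // [p^T _ _]mxE; ring.
rewrite mxE (eq_bigr _ (fun i _ => E i)).
move=> /eqP; rewrite psumr_eq0 => [/allP h|i _]; last first.
  by rewrite mulr_ge0 ?sqr_ge0 // ltW // divr_gt0.
apply/colP => i; have := h i (mem_index_enum _).
rewrite implyTb mulf_eq0 gt_eqF ?divr_gt0 //= expf_eq0 /= => /eqP ->.
by rewrite mxE.
Qed.

(** The exact solution, with zero error vector, is always an admissible answer; hence the iteration
    never gets stuck. *)
Lemma SolveV_exists A z p (delta : R) : row_free A -> positive_iterate z ->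
  0 < delta -> exists dy v, SolveV A z p delta dy v.
Proof.
move=> Afree zP d0; exists (invmx (A *m scaling2 z *m A^T) *m p), 0.
by split; rewrite ?norm2_0 // mulmx0 addr0 mulKVmx // normal_matrix_unit.
Qed.

Lemma duality_measureE z :
  duality_measure z = n%:R^-1 * \sum_i primal z i 0 * slack z i 0.
Proof.
by rewrite /duality_measure mxE; under eq_bigr do rewrite mxE.
Qed.

Lemma primal_moveE z (alpha : R) dx dy ds i :
  primal (move z alpha dx dy ds) i 0 = primal z i 0 + alpha * dx i 0.
Proof. by rewrite !mxE. Qed.

Lemma slack_moveE z (alpha : R) dx dy ds i :
  slack (move z alpha dx dy ds) i 0 = slack z i 0 + alpha * ds i 0.
Proof. by rewrite !mxE. Qed.

Definition centrality_gap z :=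
  entrywise_mul (primal z) (slack z) - duality_measure z *: ones R n.

Lemma centrality_gapE z i :
  centrality_gap z i 0 = primal z i 0 * slack z i 0 - duality_measure z.
Proof. by rewrite !mxE mulr1. Qed.

Lemma in_N2_complementarity_ge theta z i : in_N2 theta z ->
  (1 - theta) * duality_measure z <= primal z i 0 * slack z i 0.
Proof.
move=> [h _]; have := le_trans (entry_le_norm2 (centrality_gap z) i) h.
rewrite centrality_gapE ler_norml => /andP[]; lra.
Qed.

(** * One error-adjusted step, for arbitrary [sigma] and step length *)

Section ErrorAdjustedStep.
Variables (A : 'M[R]_(m, n)) (sigma : R) (z : iterate R m n).
Variables (dy : 'cV[R]_m) (v : 'cV[R]_n).
Hypothesis z_pos : positive_iterate z.
Let x := primal z.
Let s := slack z.
Let mu := duality_measure z.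
Let dx := step_dx A sigma z dy v.
Let ds := step_ds A dy.
Let x_gt0 i : 0 < x i 0. Proof. by case: z_pos => /(_ i). Qed.
Let s_gt0 i : 0 < s i 0. Proof. by case: z_pos => _ /(_ i). Qed.

Lemma step_dxE i : dx i 0 =
  - x i 0 + sigma * mu / s i 0 - x i 0 / s i 0 * ds i 0 - v i 0 / s i 0.
Proof.
have [_ s0] := z_pos.
have E (a t d e : 'cV[R]_n) (r : R) :
  (- a + r *: t - d - e) i 0 = - a i 0 + r * t i 0 - d i 0 - e i 0.
  by rewrite !mxE.
rewrite /dx /step_dx -/ds E scaling2_mulE // !Sinv_mulE // [ones R n i 0]mxE.
by rewrite mulr1 [v i 0 / _]mulrC.
Qed.

Lemma step_newton i : s i 0 * dx i 0 + x i 0 * ds i 0 =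
  sigma * mu - x i 0 * s i 0 - v i 0.
Proof. by rewrite step_dxE; have := s_gt0 i => h; field; rewrite gt_eqF. Qed.

Variables (delta : R).
(** One right-hand side for both steps: [sigma = 0] yields the predictor system, [sigma = 1] the
    corrector system. *)
Hypothesis solved :
  SolveV A z (- ((sigma * mu) *: (A *m Sinv z *m ones R n)) + A *m x)
    delta dy v.

(** The correction [- Sinv z *m v] in [dx] cancels exactly the error [A *m Sinv z *m v] of the
    solved system. *)
Lemma step_primal_kernel : A *m dx = 0.
Proof.
have [h _] := solved.
rewrite /dx /step_dx /step_ds; move: (scaling2 z) (Sinv z) h => D2 Si h.
rewrite !mulmxBr mulmxDr !mulmxN opprK !mulmxA h.
rewrite -scalemxAr !mulmxA -/x -/mu.
by apply/colP => i; rewrite !mxE; ring.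
Qed.

(** [dx] lies in the kernel of [A] and [ds] in the range of [A^T]. *)
Lemma step_orthogonal : \sum_i dx i 0 * ds i 0 = 0.
Proof.
have -> : \sum_i dx i 0 * ds i 0 = (dx^T *m ds) 0 0.
  by rewrite mxE; under [RHS]eq_bigr do rewrite mxE.
rewrite /ds /step_ds mulmxN mulmxA -trmx_mul step_primal_kernel trmx0.
by rewrite mul0mx oppr0 mxE.
Qed.

(* [dx_i] and [ds_i] are rescaled by [sqrt (s_i / x_i)] and [sqrt (x_i / s_i)]:
   the results are orthogonal, so their squared norms add up to that of their
   sum, and AM-GM bounds each [|dx_i ds_i|]. *)
Lemma norm2_step_product : norm2 (entrywise_mul dx ds) <=
  2^-1 * \sum_i (sigma * mu - x i 0 * s i 0 - v i 0) ^+ 2 / (x i 0 * s i 0).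
Proof.
apply: le_trans (norm2_le_sum_norm _) _.
pose pq i := s i 0 / x i 0 * dx i 0 ^+ 2 + x i 0 / s i 0 * ds i 0 ^+ 2.
have E i : (sigma * mu - x i 0 * s i 0 - v i 0) ^+ 2 / (x i 0 * s i 0) =
    pq i + 2 * (dx i 0 * ds i 0).
  rewrite -step_newton /pq; have := x_gt0 i => ?; have := s_gt0 i => ?.
  by field; rewrite !gt_eqF.
rewrite (eq_bigr _ (fun i _ => E i)) big_split /= -mulr_sumr step_orthogonal.
rewrite mulr0 addr0 mulr_sumr; apply: ler_sum => i _; rewrite mxE.
have xi := x_gt0 i; have si := s_gt0 i.
have key e : e ^+ 2 = 1 -> e * (dx i 0 * ds i 0) <= 2^-1 * pq i.
  move=> e2; rewrite -subr_ge0.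
  have -> : 2^-1 * pq i - e * (dx i 0 * ds i 0) =
      2^-1 * ((s i 0 * dx i 0 - e * (x i 0 * ds i 0)) ^+ 2 / (x i 0 * s i 0)).
    have -> : (s i 0 * dx i 0 - e * (x i 0 * ds i 0)) ^+ 2 =
      (s i 0 * dx i 0) ^+ 2 - 2 * e * (s i 0 * dx i 0 * (x i 0 * ds i 0))
       + e ^+ 2 * (x i 0 * ds i 0) ^+ 2 by ring.
    by rewrite e2 /pq; field; rewrite !gt_eqF.
  by rewrite mulr_ge0 // mulr_ge0 ?sqr_ge0 // invr_ge0 mulr_ge0 // ltW.
rewrite ler_norml lerNl; apply/andP; split.
  by rewrite -mulN1r key // sqrrN expr1n.
by rewrite -[leLHS]mul1r key // expr1n.
Qed.

Variable alpha : R.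
Let z' := move z alpha dx dy ds.

Lemma step_complementarity i : primal z' i 0 * slack z' i 0 =
  (1 - alpha) * (x i 0 * s i 0) + alpha * (sigma * mu - v i 0)
  + alpha ^+ 2 * (dx i 0 * ds i 0).
Proof.
rewrite primal_moveE slack_moveE -/x -/s.
transitivity (x i 0 * s i 0 + alpha * (s i 0 * dx i 0 + x i 0 * ds i 0)
  + alpha ^+ 2 * (dx i 0 * ds i 0)); first ring.
rewrite step_newton; ring.
Qed.

Hypothesis n_gt0 : (0 < n)%N.

Lemma step_duality_measure : duality_measure z' =
  (1 - alpha + alpha * sigma) * mu - alpha * (n%:R^-1 * \sum_i v i 0).
Proof.
have nR : n%:R != 0 :> R by rewrite pnatr_eq0 -lt0n.
rewrite duality_measureE; under eq_bigr do rewrite step_complementarity.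
rewrite !big_split /= -!mulr_sumr step_orthogonal mulr0 addr0 sumrB.
rewrite sumr_const card_ord -mulr_natl /mu duality_measureE -/x -/s.
by field.
Qed.

Lemma norm_mean_error_le : `|n%:R^-1 * \sum_i v i 0| <= norm2 v / Num.sqrt n%:R.
Proof.
have q0 : Num.sqrt n%:R != 0 :> R by rewrite gt_eqF // sqrtr_gt0 ltr0n.
rewrite normrM ger0_norm ?invr_ge0 ?ler0n //.
have -> : norm2 v / Num.sqrt n%:R = n%:R^-1 * (Num.sqrt n%:R * norm2 v).
  rewrite -[in RHS](@sqr_sqrtr _ n%:R) ?ler0n // sqrtr_sqr.
  by rewrite ger0_norm ?sqrtr_ge0 //; field.
by rewrite ler_wpM2l ?invr_ge0 ?ler0n // norm_sum_le_norm2.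
Qed.

(** The [sigma * mu] terms cancel, so the new gap combines the old gap, the centered error and
    [dx o ds]; centering does not increase the norm of [v]. *)
Lemma step_centrality_gap : 0 <= alpha <= 1 ->
  norm2 (centrality_gap z') <= (1 - alpha) * norm2 (centrality_gap z)
    + alpha * norm2 v + alpha ^+ 2 * norm2 (entrywise_mul dx ds).
Proof.
move=> /andP[a0 a1].
have -> : centrality_gap z' = (1 - alpha) *: centrality_gap z
    + - (alpha *: (v - (n%:R^-1 * \sum_i v i 0) *: ones R n))
    + alpha ^+ 2 *: entrywise_mul dx ds.
  have E (u w g : 'cV[R]_n) (r1 r2 r3 t : R) i :
    (r1 *: u + - (r2 *: (w - t *: ones R n)) + r3 *: g) i 0 =
    r1 * u i 0 - r2 * (w i 0 - t) + r3 * g i 0 by rewrite !mxE mulr1.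
  apply/colP => i; rewrite E !centrality_gapE step_complementarity.
  rewrite step_duality_measure entrywise_mulE -/x -/s -/mu; ring.
apply: le_trans (norm2D _ _) _; rewrite norm2Z ger0_norm ?sqr_ge0 // lerD2r.
apply: le_trans (norm2D _ _) _; rewrite norm2N !norm2Z !ger0_norm ?subr_ge0 //.
by rewrite lerD2l ler_wpM2l // norm2_centered.
Qed.

Lemma step_positive :
  (forall i, 0 < primal z' i 0 * slack z' i 0) ->
  (forall i,
    0 < (2 - alpha) * (x i 0 * s i 0) + alpha * (sigma * mu - v i 0)) ->
  positive_iterate z'.
Proof.
move=> prod_gt0 sum_gt0.
(* The products [x'_i s'_i] are positive, so both factors have the same sign; it
   is positive because [s_i x'_i + x_i s'_i > 0]. *)
have both i : 0 < primal z' i 0 /\ 0 < slack z' i 0.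
  have sum_i : 0 < s i 0 * primal z' i 0 + x i 0 * slack z' i 0.
    suff <- : (2 - alpha) * (x i 0 * s i 0) + alpha * (sigma * mu - v i 0) =
        s i 0 * primal z' i 0 + x i 0 * slack z' i 0 by [].
    rewrite primal_moveE slack_moveE -/x -/s.
    transitivity (2 * (x i 0 * s i 0)
       + alpha * (s i 0 * dx i 0 + x i 0 * ds i 0)); last by ring.
    rewrite step_newton; ring.
  have := prod_gt0 i; have := x_gt0 i; have := s_gt0 i; move: sum_i.
  move: (primal z' i 0) (slack z' i 0) => a b sum_i si xi ab.
  have [a_gt0|a_le0] := ltP 0 a; first by rewrite -(pmulr_rgt0 _ a_gt0).
  have : b < 0 by rewrite ltNge; apply/negP => b0; nra.
  nra.
by split => i; case: (both i).
Qed.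

(** With [theta < 1] the gap bound keeps every new product at least [(1 - theta) mu' > 0], which
    supplies the first premise of [step_positive]. *)
Lemma step_in_N2 theta :
  norm2 (centrality_gap z') <= theta * duality_measure z' ->
  theta < 1 -> 0 < duality_measure z' ->
  (forall i,
    0 < (2 - alpha) * (x i 0 * s i 0) + alpha * (sigma * mu - v i 0)) ->
  in_N2 theta z'.
Proof.
move=> gap theta1 mu'0 sum_gt0; split=> //; apply: step_positive => // i.
have := le_trans (entry_le_norm2 (centrality_gap z') i) gap.
rewrite centrality_gapE ler_norml => /andP[]; nra.
Qed.

Lemma step_feasible b c : A *m x = b -> A^T *m dual z + s = c ->
  A *m primal z' = b /\ A^T *m dual z' + slack z' = c.
Proof.
move=> pb dc; split.
  by rewrite /= mulmxDr -scalemxAr step_primal_kernel scaler0 addr0.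
rewrite /= mulmxDr -scalemxAr /ds /step_ds scalerN -dc -/s.
by rewrite addrACA subrr addr0.
Qed.

End ErrorAdjustedStep.

End Step.

(** * Elementary bounds on sqrt n and its inverse *)

Lemma sqrt_natr_ge1 (R : realType) (n : nat) :
  (0 < n)%N -> 1 <= Num.sqrt n%:R :> R.
Proof. by move=> n0; rewrite -[leLHS]sqrtr1 ler_wsqrtr // ler1n. Qed.

Lemma inv_sqrt_natr_itv (R : realType) (n : nat) :
  (0 < n)%N -> 0 < (Num.sqrt n%:R : R)^-1 <= 1.
Proof.
move=> /(sqrt_natr_ge1 R) q1; have q0 := lt_le_trans ltr01 q1.
by rewrite invr_gt0 q0 invf_le1.
Qed.

(** * Predictor and corrector estimates, and geometric decrease of the duality measure *)

Section Convergence.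
Variables (R : realType) (m n : nat).
Implicit Types (z w : iterate R m n) (A : 'M[R]_(m, n)) (v dx ds : 'cV[R]_n).

(** For n = 0 the convention [0^-1 = 0] makes the duality measure zero. *)
Lemma duality_measure_gt0_dim z : 0 < duality_measure z -> (0 < n)%N.
Proof.
case: (posnP n) => // n0; have nR0 : n%:R = 0 :> R by rewrite n0.
by rewrite /duality_measure nR0 invr0 mul0r ltxx.
Qed.

(** With P the norm of [dx o ds], the square root in the minimum gives [a^2 P <= mu / 16]; and
    [P <= n mu] makes that root at least [1 / (4 sqrt n)]. *)
Lemma predictor_step_sizeP (mu : R) dx ds (a := predictor_step_size mu dx ds) :
  0 < mu ->
  [/\ 0 < a, a <= 2^-1, a ^+ 2 * norm2 (entrywise_mul dx ds) <= mu / 16 &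
    ((0 < n)%N -> norm2 (entrywise_mul dx ds) <= n%:R * mu ->
      (Num.sqrt n%:R)^-1 / 4 <= a)].
Proof.
move=> mu0; rewrite /a /predictor_step_size.
have tn : (0 < n)%N -> (Num.sqrt n%:R)^-1 / 4 <= 2^-1 :> R.
  move=> /(inv_sqrt_natr_itv R)/andP[_].
  lra.
case: eqP => [->|/eqP u0].
  by rewrite norm2_0 mulr0; split=> // [|n0 _]; [lra|exact: tn].
set P := norm2 _.
have P0 : 0 < P.
  rewrite lt_neqAle norm2_ge0 andbT eq_sym; apply: contra u0 => /eqP P0.
  apply/eqP/colP => i; have := entry_le_norm2 (entrywise_mul dx ds) i.
  by rewrite -/P P0 normr_le0 => /eqP ->; rewrite mxE.
have q0 : 0 < mu / (16 * P) by rewrite divr_gt0 // mulr_gt0.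
split.
- by rewrite lt_min sqrtr_gt0 q0; lra.
- by rewrite ge_min lexx.
- have -> : mu / 16 = Num.sqrt (mu / (16 * P)) ^+ 2 * P.
    by rewrite sqr_sqrtr ?ltW //; field; rewrite gt_eqF.
  rewrite ler_wpM2r ?(ltW P0) // ler_sqr ?nnegrE ?sqrtr_ge0 //.
  by rewrite ge_min lexx orbT.
- move=> n0 Pn; rewrite le_min tn //=.
  have nR : 0 < n%:R :> R by rewrite ltr0n.
  have qn : 0 < Num.sqrt n%:R :> R by rewrite sqrtr_gt0.
  rewrite -[leLHS]ger0_norm ?divr_ge0 ?invr_ge0 ?sqrtr_ge0 //.
  rewrite -sqrtr_sqr ler_wsqrtr // exprMn exprVn sqr_sqrtr ?ler0n //.
  rewrite ler_pdivlMr ?mulr_gt0 //.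
  have -> : n%:R^-1 * 4^-1 ^+ 2 * (16 * P) = P / n%:R by field; rewrite gt_eqF.
  by rewrite ler_pdivrMr // mulrC.
Qed.

Lemma predictor_step_bounds A b c (eps : R) z w :
  0 < eps -> in_N2 4^-1 z -> 2 * eps <= duality_measure z ->
  A *m primal z = b -> A^T *m dual z + slack z = c ->
  predictor_step A eps z w ->
  [/\ in_N2 (2 / 5) w, 255 / 256 * eps <= duality_measure w,
    duality_measure w <=
      (1 - 255 / 1024 / Num.sqrt n%:R) * duality_measure z,
    A *m primal w = b & A^T *m dual w + slack w = c].
Proof.
move=> eps0 zN mu2 pb dc [zP [dy [v [solv wE]]]].
have mu0 : 0 < duality_measure z by lra.
have n0 := duality_measure_gt0_dim mu0.
have solved : SolveV A z
    (- ((0 * duality_measure z) *: (A *m Sinv z *m ones R n)) + A *m primal z)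
    (eps / 2 ^+ 7) dy v.
  by rewrite mul0r scale0r oppr0 add0r.
have V_lt : norm2 v < eps / 2 ^+ 7 by case: solv.
have V0 := norm2_ge0 v.
have xs_ge i := in_N2_complementarity_ge i zN.
have v_le i := entry_le_norm2 v i.
(* The tolerance is [eps / 128], and [eps <= mu / 2] while the loop runs. *)
have V_le : norm2 v <= duality_measure z / 256.
  by apply: le_trans (ltW V_lt) _; lra.
have P_le := norm2_step_product zP solved.
have [a0 a_le aP a_ge] := predictor_step_sizeP
  (step_dx A 0 z dy v) (step_ds A dy) mu0.
set a := predictor_step_size _ _ _ in wE a0 a_le aP a_ge.
(* Each summand [(t + u)^2 / t] is at most [2 t], because [|u| <= mu / 256] is small against
   [t >= 3/4 mu]; the products [t] sum to [n mu]. *)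
have {}a_ge : (Num.sqrt n%:R)^-1 / 4 <= a.
  apply: a_ge => //; apply: le_trans P_le _.
  have -> : n%:R * duality_measure z =
      2^-1 * \sum_i 2 * (primal z i 0 * slack z i 0).
    rewrite -mulr_sumr duality_measureE; field.
    by rewrite pnatr_eq0 -lt0n.
  rewrite ler_wpM2l ?invr_ge0 //; apply: ler_sum => i _.
  have := xs_ge i; have := v_le i; rewrite ler_norml => /andP[].
  move: (primal z i 0 * slack z i 0) (v i 0) => t u u1 u2 t1.
  have t0 : 0 < t by lra.
  rewrite ler_pdivrMr //; nra.
have mean_le := norm_mean_error_le v n0.
have muE := step_duality_measure zP solved a n0.
have a01 : 0 <= a <= 1 by apply/andP; split; lra.
have gap_le := step_centrality_gap zP solved n0 a01.
rewrite -wE in muE gap_le.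
have /andP[t0 t_le1] := inv_sqrt_natr_itv R n0.
have [zgap _] := zN; rewrite -/(centrality_gap z) in zgap.
have aV : a * norm2 v <= a * duality_measure z / 256.
  by rewrite -mulrA ler_wpM2l // (ltW a0).
have amu : a * duality_measure z <= duality_measure z / 2.
  by rewrite mulrC ler_wpM2l // ltW.
have tV : norm2 v / Num.sqrt n%:R <= norm2 v by rewrite ler_piMr.
move: mean_le muE; set M := n%:R^-1 * _; rewrite ler_norml => /andP[M1 M2] muE.
have aM : - (a * norm2 v) <= a * M <= a * norm2 v.
  by apply/andP; split; rewrite -?mulrN ler_wpM2l ?(ltW a0) //; lra.
have [aM1 aM2] := andP aM.
(* From [a <= 1/2] and an error term of at most [a mu / 256]: [1/2 - 1/512 = 255/512]. *)
have mu'_ge : 255 / 512 * duality_measure z <= duality_measure w.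
  rewrite muE; lra.
split.
- rewrite wE; apply: (step_in_N2 zP); rewrite -?wE; [|lra|lra|].
    (* To compare: [(1 - a)/4 + a/256 + 1/16] against [2/5 (1 - a - a/256)]. Both are linear in [a],
       and the tightest case is [a = 1/2]. *)
    apply: le_trans gap_le _.
    have : (1 - a) * norm2 (centrality_gap z) <=
        (1 - a) * (4^-1 * duality_measure z) by rewrite ler_wpM2l //; lra.
    rewrite muE; lra.
  move=> i; have := xs_ge i; have := v_le i; rewrite ler_norml => /andP[].
  move: (primal z i 0 * slack z i 0) (v i 0) => t u _ u2 t1.
  rewrite -/a mul0r sub0r.
  have au : a * u <= a * norm2 v by rewrite ler_wpM2l // (ltW a0).
  have t_gt0 : 0 < t by lra.
  have ta : 3 / 2 * t <= (2 - a) * t by rewrite ler_wpM2r ?(ltW t_gt0) //; lra.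
  lra.
- lra.
- rewrite muE.
  (* Hence [mu' <= (1 - 255/256 a) mu], and [a >= 1 / (4 sqrt n)] gives the rate 255/1024. *)
  have : a * - M <= a * (duality_measure z / 256).
    by rewrite ler_wpM2l ?(ltW a0) //; lra.
  have : (Num.sqrt n%:R)^-1 / 4 * (255 / 256 * duality_measure z) <=
    a * (255 / 256 * duality_measure z) by rewrite ler_wpM2r //; lra.
  lra.
- by rewrite wE; have [] := step_feasible solved a pb dc.
- by rewrite wE; have [] := step_feasible solved a pb dc.
Qed.

Lemma corrector_step_bounds A b c (eps : R) w z :
  0 < eps -> in_N2 (2 / 5) w -> 255 / 256 * eps <= duality_measure w ->
  A *m primal w = b -> A^T *m dual w + slack w = c ->
  corrector_step A eps w z ->
  [/\ in_N2 4^-1 z,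
    duality_measure z <= duality_measure w + eps / 128 / Num.sqrt n%:R,
    A *m primal z = b & A^T *m dual z + slack z = c].
Proof.
move=> eps0 wN mu1 pb dc [wP [dy [v [solv zE]]]].
have mu0 : 0 < duality_measure w by lra.
have n0 := duality_measure_gt0_dim mu0.
have solved : SolveV A w
    (- ((1 * duality_measure w) *: (A *m Sinv w *m ones R n)) + A *m primal w)
    (eps / 2 ^+ 7) dy v by rewrite mul1r.
have V_lt : norm2 v < eps / 2 ^+ 7 by case: solv.
have V0 := norm2_ge0 v.
have xs_ge i := in_N2_complementarity_ge i wN.
have v_le i := entry_le_norm2 v i.
(* Here only [eps <= 256/255 mu] is available, and [256/255 / 128 = 2/255]. *)
have V_le : norm2 v <= duality_measure w * (2 / 255).
  by apply: le_trans (ltW V_lt) _; lra.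
have [wgap _] := wN; rewrite -/(centrality_gap w) in wgap.
have P_le : norm2 (entrywise_mul (step_dx A 1 w dy v) (step_ds A dy)) <=
    15 / 100 * duality_measure w.
  apply: le_trans (norm2_step_product wP solved) _.
  (* [2/5 + 2/255 < 41/100]. As every product is at least [3/5 mu], the bound becomes
     [1/2 (41/100)^2 / (3/5) < 15/100]. *)
  have res_le : norm2 (centrality_gap w + v) <= 41 / 100 * duality_measure w.
    by apply: le_trans (norm2D _ _) _; lra.
  apply: (@le_trans _ _ (2^-1 * ((3 / 5 * duality_measure w)^-1 *
      norm2 (centrality_gap w + v) ^+ 2))).
    rewrite ler_wpM2l ?invr_ge0 // sqr_norm2 mulr_sumr; apply: ler_sum => i _.
    rewrite mul1r [(_ + v) i 0]mxE centrality_gapE mulrC.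
    have -> : (primal w i 0 * slack w i 0 - duality_measure w + v i 0) ^+ 2 =
      (duality_measure w - primal w i 0 * slack w i 0 - v i 0) ^+ 2 by ring.
    rewrite ler_wpM2r ?sqr_ge0 // lef_pV2 ?posrE.
    + by have := xs_ge i; lra.
    + by have := xs_ge i; lra.
    + by lra.
  have sq_le : norm2 (centrality_gap w + v) ^+ 2 <=
      (41 / 100 * duality_measure w) ^+ 2.
    by rewrite ler_sqr ?nnegrE ?norm2_ge0 //; lra.
  rewrite mulrCA [X in X <= _]mulrC ler_pdivrMr; [nra|lra].
have mean_le := norm_mean_error_le v n0.
have muE := step_duality_measure wP solved 1 n0.
have one01 : 0 <= (1 : R) <= 1 by rewrite ler01 lexx.
have gap_le := step_centrality_gap wP solved n0 one01.
rewrite -zE in gap_le.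
rewrite -zE !mul1r subrr add0r mul1r in muE.
rewrite subrr mul0r add0r mul1r expr1n mul1r in gap_le.
have /andP[t0 t_le1] := inv_sqrt_natr_itv R n0.
have tV : norm2 v / Num.sqrt n%:R <= norm2 v by rewrite ler_piMr.
move: mean_le muE; set M := n%:R^-1 * _; rewrite ler_norml => /andP[M1 M2] muE.
split.
- rewrite zE; apply: (step_in_N2 wP); rewrite -?zE; [|lra|lra|].
    (* At full step length the old gap drops out: [2/255 + 15/100] is below a quarter of
       [253/255]. *)
    by apply: le_trans gap_le _; rewrite muE; lra.
  move=> i; have := xs_ge i; have := v_le i; rewrite ler_norml => /andP[]; lra.
- rewrite muE.
  have : norm2 v / Num.sqrt n%:R <= eps / 128 / Num.sqrt n%:R.
    rewrite ler_wpM2r ?invr_ge0 ?sqrtr_ge0 //.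
    by apply: le_trans (ltW V_lt) _; lra.
  lra.
- by rewrite zE; have [] := step_feasible solved 1 pb dc.
- by rewrite zE; have [] := step_feasible solved 1 pb dc.
Qed.

(** Induction on [k]: each outer iteration returns to N_2(1/4), keeps feasibility and contracts [mu]
    by [1 - 1 / (8 sqrt n)]. For [k = 0] the hypothesis says that the loop test already fails. *)
Lemma terminates_within_geometric A b c (eps : R) k z :
  row_free A -> 0 < eps -> in_N2 4^-1 z ->
  A *m primal z = b -> A^T *m dual z + slack z = c ->
  (1 - (Num.sqrt n%:R)^-1 / 8) ^+ k * duality_measure z < 2 * eps ->
  terminates_within A eps
    (fun z => primal_dual_feasible A b c z /\ duality_measure z < 2 * eps) k z.
Proof.
move=> Afree eps0; have d0 : 0 < eps / 2 ^+ 7 by rewrite divr_gt0.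
elim: k z => [|k IHk] z zN pb dc; have [_ zP] := zN.
  rewrite expr0 mul1r /= leNgt => lt_mu; rewrite lt_mu /=; split => //.
  by case: zP => x0 s0; split=> // i; exact: ltW.
rewrite /=; case: ifPn => [mu2 lt_mu|]; last first.
  rewrite -ltNge => lt_mu _; split => //.
  by case: zP => x0 s0; split=> // i; exact: ltW.
split.
  split.
    have [dy [v h]] := SolveV_exists (A *m primal z) Afree zP d0.
    by eexists; split=> //; exists dy, v; split; [exact: h|reflexivity].
  move=> w /(predictor_step_bounds eps0 zN mu2 pb dc) [[_ wP] _ _ _ _].
  have [dy [v h]] := SolveV_exists
    (- (duality_measure w *: (A *m Sinv w *m ones R n)) + A *m primal w)
    Afree wP d0.
  by eexists; split=> //; exists dy, v; split; [exact: h|reflexivity].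
move=> z' [w /(predictor_step_bounds eps0 zN mu2 pb dc)].
move=> [wN mu_w_ge mu_w_le pbw dcw].
move=> /(corrector_step_bounds eps0 wN mu_w_ge pbw dcw)[zN' mu_z' pb' dc'].
apply: IHk => //; apply: le_lt_trans lt_mu.
have mu0 : 0 < duality_measure z by lra.
have n0 := duality_measure_gt0_dim mu0.
have /andP[t0 t_le1] := inv_sqrt_natr_itv R n0.
rewrite exprSr -mulrA ler_wpM2l ?exprn_ge0 //; first lra.
(* The corrector's increase [eps / (128 sqrt n)] is thus at most [mu / (256 sqrt n)], and
   [255/1024 - 1/256 > 1/8]. *)
have : (Num.sqrt n%:R)^-1 * (2 * eps) <= (Num.sqrt n%:R)^-1 * duality_measure z.
  by rewrite ler_wpM2l // ltW.
have := mulr_gt0 t0 mu0; lra.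
Qed.

End Convergence.

Theorem theorem2 (R : realType) :
  exists2 C : R, 0 < C &
  forall (m n : nat) (A : 'M[R]_(m, n)) (b : 'cV[R]_m) (c : 'cV[R]_n)
    (eps : R) (z0 : iterate R m n),
    (m <= n)%N -> row_free A -> 0 < eps ->
    in_N2 4^-1 z0 ->
    A *m primal z0 = b -> A^T *m dual z0 + slack z0 = c ->
    2 * eps <= duality_measure z0 ->
    exists2 K : nat,
      K%:R <= C * Num.sqrt n%:R * ln (duality_measure z0 / eps) &
      terminates_within A eps
        (fun z => primal_dual_feasible A b c z /\ duality_measure z < 2 * eps)
        K z0.
Proof.
(* About [8 sqrt n L] iterations suffice; rounding up adds at most 1, which is at most [2 sqrt n L]
   since [sqrt n L >= 1/2]. *)
exists 10; first by [].
move=> m n A b c eps z0 _ Afree eps0 z0N pb dc mu2.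
have mu0 : 0 < duality_measure z0 by lra.
have n0 := duality_measure_gt0_dim mu0.
have q1 := sqrt_natr_ge1 R n0.
have /andP[t0 t_le1] := inv_sqrt_natr_itv R n0.
have ratio0 : 0 < duality_measure z0 / eps by rewrite divr_gt0.
set L := ln _.
(* [L >= ln 2] since [mu0 >= 2 eps], and [ln 2 = - ln (1 - 1/2) >= 1/2]. *)
have L_ge : 2^-1 <= L.
  have ln_half : ln (1 + - 2^-1) <= - 2^-1 :> R by apply: le_ln1Dx; lra.
  have ln2 : ln 2 = - ln (1 + - 2^-1) :> R.
    by rewrite -lnV ?posrE; [congr ln; field|lra].
  have : ln 2 <= L by rewrite ler_ln ?posrE // ler_pdivlMr.
  lra.
move: (Num.sqrt n%:R) q1 t0 t_le1 (@terminates_within_geometric R m n)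
  => q q1 t0 t_le1 geometric.
have qL : 2^-1 <= q * L by nra.
have [K K_le K_ge] : exists2 K : nat, K%:R <= 10 * q * L & 8 * q * L <= K%:R.
  have trunc_le : (Num.truncn (8 * q * L))%:R <= 8 * q * L.
    by rewrite truncn_le; lra.
  exists (Num.truncn (8 * q * L)).+1; last by rewrite ltW // truncnS_gt.
  by rewrite -natr1; move: trunc_le; move: (_%:R) => k; lra.
exists K => //; apply: geometric => //.
(* Reaching [eps] rather than [2 * eps] provides the strict inequality. *)
suff h : (1 - q^-1 / 8) ^+ K <= eps / duality_measure z0.
  apply: (@le_lt_trans _ _ (eps / duality_measure z0 * duality_measure z0)).
    by rewrite ler_wpM2r // ltW.
  by rewrite divfK ?(gt_eqF mu0) // ltr_pMl // ltr1n.
(* By [1 + x <= exp x], the power is at most [exp (- K / (8 q))], and [K >= 8 q L] brings this below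
   [exp (- L) = eps / mu0]. *)
apply: (@le_trans _ _ (expR (- (q^-1 / 8)) ^+ K)).
  by rewrite lerXn2r ?nnegrE ?expR_ge0 ?expR_ge1Dx //; lra.
rewrite -expRM_natl.
have -> : eps / duality_measure z0 = expR (- L).
  by rewrite expRN lnK ?posrE // invf_div.
rewrite ler_expR mulrN lerN2.
have -> : L = 8 * q * L * (q^-1 / 8) by field; lra.
by rewrite ler_wpM2r //; lra.
Qed.
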